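(* Let $\Gamma=(G,f,q,N)$ be an influence game with positive labeling function $f$. Then the oblivious influence model $\mathcal{M}^o(\Gamma)$ and the non-oblivious influence model $\mathcal{M}^n(\Gamma)$ are both monotonic.
   Context: Graphs are finite, directed, without loops or multiple edges; $P(i)=P_G(i)=\{j\mid (j,i)\in E\}$. An influence graph is a pair $(G,f)$ with $G=(V,E)$ a digraph and $f$ assigning to each vertex a non-negative rational. For $X\subseteq V$, $n=|V|$: $F^0(X)=X$, $F^t(X)=F^{t-1}(X)\cup\{i\in V\mid |P_G(i)\cap F^{t-1}(X)|\ge f(i)\}$ for $1\le t\le n$, and $F(X)=F^n(X)$. An influence game is $\Gamma=(G,f,q,N)$ with $(G,f)$ an influence graph, $q$ an integer, $0\le q\le n$, and $N\subseteq V$. For $x\in\{0,1\}^n$ let $X(x)=\{i\mid x_i=1\}$. The model $\mathcal{M}^o(\Gamma)$ has collective decision function $C(x)=1$ if $|F(X(x)\cap N)|\ge q$ and $C(x)=0$ otherwise. The model $\mathcal{M}^n(\Gamma)$: let $p_i(x)=|F(X(x)\cap N)\cap P(i)|$, $q_i(x)=|P(i)\setminus F(X(x)\cap N)|$. For $i\in V\setminus N$: $c_i=1$ if $p_i(x)\ge f(i)$ and $q_i(x)<f(i)$; $c_i=0$ if $q_i(x)\ge f(i)$ and $p_i(x)<f(i)$; $c_i=x_i$ otherwise. For $i\in N$: $c_i=1$ if $i\in F(X(x))$, else $c_i=0$. Then $C(x)=1$ if $|\{i\in V\mid c_i=1\}|\ge q$ and $C(x)=0$ otherwise. A model on actor set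 $V$ is monotonic if $X(x)\subseteq X(x')$ implies $C(x)\le C(x')$. *)

(* Defs.v *)
From HB Require Import structures.
From mathcomp Require Import all_boot all_order all_algebra.

Set Implicit Arguments.
Unset Strict Implicit.
Unset Printing Implicit Defensive.

Import Order.TTheory GRing.Theory Num.Theory.
Local Open Scope ring_scope.

Record digraph (V : finType) := Digraph {
  edge :> rel V; (* [edge j i] is the arc (j, i), from j to i *)
  edge_irreflexive : irreflexive edge
}.

Definition preds (V : finType) (G : digraph V) (i : V) : {set V} :=
  [set j | G j i].

Record influence_graph (V : finType) := InfluenceGraph {
  graph_of :> digraph V;
  label : V -> rat;
  label_ge0 : forall i, 0 <= label i
}.

(* [spread_at Gf t X] is F^t(X) and [spread Gf X] is F(X) = F^n(X), n = #|V|. *)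
Fixpoint spread_at (V : finType) (Gf : influence_graph V) (t : nat)
    (X : {set V}) : {set V} :=
  if t is t'.+1 then
    let Y := spread_at Gf t' X in
    Y :|: [set i | label Gf i <= #|preds Gf i :&: Y|%:R]
  else X.

Definition spread (V : finType) (Gf : influence_graph V) (X : {set V}) :
    {set V} :=
  spread_at Gf #|V| X.

Record influence_game (V : finType) := InfluenceGame {
  influence_graph_of :> influence_graph V;
  quota : int;
  quota_bounds : 0 <= quota <= #|V|%:Z;
  players : {set V}
}.

(* Decisions 0 and 1 are the booleans, and a vector x in {0,1}^n is indexed
   directly by the actors. A model is given by its collective decision
   function C. *)
Definition decisions (V : finType) := {ffun V -> bool}.

Definition model (V : finType) := decisions V -> bool.

Definition supporters (V : finType) (x : decisions V) : {set V} :=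
  [set i | x i].

Definition oblivious_model (V : finType) (Gam : influence_game V) : model V :=
  fun x => quota Gam <= #|spread Gam (supporters x :&: players Gam)|%:Z.

Definition count_for (V : finType) (Gam : influence_game V)
    (x : decisions V) (i : V) : nat :=
  #|spread Gam (supporters x :&: players Gam) :&: preds Gam i|.

Definition count_against (V : finType) (Gam : influence_game V)
    (x : decisions V) (i : V) : nat :=
  #|preds Gam i :\: spread Gam (supporters x :&: players Gam)|.

(* For a player the spread starts from the whole of X(x), not from
   X(x) restricted to the players. *)
Definition final_decision (V : finType) (Gam : influence_game V)
    (x : decisions V) (i : V) : bool :=
  let p : rat := (count_for Gam x i)%:R in
  let q : rat := (count_against Gam x i)%:R in
  if i \in players Gam then i \in spread Gam (supporters x)
  else if (label Gam i <= p) && (q < label Gam i) then true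
  else if (label Gam i <= q) && (p < label Gam i) then false
  else x i.

Definition non_oblivious_model (V : finType) (Gam : influence_game V) :
    model V :=
  fun x => quota Gam <= #|[set i | final_decision Gam x i]|%:Z.

Definition monotonic (V : finType) (C : model V) : Prop :=
  forall x x' : decisions V,
    supporters x \subset supporters x' -> (C x <= C x')%N.

(* Main.v *)
Require Import Defs.
From mathcomp Require Import all_boot all_order all_algebra.

Set Implicit Arguments.
Unset Strict Implicit.
Unset Printing Implicit Defensive.

Import Order.TTheory GRing.Theory Num.Theory.
Local Open Scope ring_scope.

(** Influence spread is monotone in its seed set ([spreadS]), which settles the oblivious model at
    once. In the non-oblivious model, a larger X(x) thus raises every p_i and lowers every q_i, so
    pressure towards 1 persists, pressure towards 0 can only vanish, and the fallback x_i grows too.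
    Hence no c_i drops from 1 to 0 ([final_decision_mono]), and the count compared with the quota
    cannot decrease. *)

Lemma spread_atS (V : finType) (Gf : influence_graph V) (t : nat)
    (X Y : {set V}) :
  X \subset Y -> spread_at Gf t X \subset spread_at Gf t Y.
Proof.
move=> sXY; elim: t => [//|t IHt] /=.
(* A threshold reached by the active predecessors in the smaller set is still reached in the larger
   one. *)
apply: setUSS => //; apply/subsetP => i; rewrite !inE => /le_trans; apply.
by rewrite ler_nat subset_leq_card // setIS.
Qed.

Lemma spreadS (V : finType) (Gf : influence_graph V) (X Y : {set V}) :
  X \subset Y -> spread Gf X \subset spread Gf Y.
Proof. exact: spread_atS. Qed.

Lemma quota_cardS (V : finType) (q : int) (A B : {set V}) :
  A \subset B -> ((q <= #|A|%:Z)%R <= (q <= #|B|%:Z)%R)%N.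
Proof.
move=> /subset_leq_card leAB; case: (boolP (q <= #|A|%:Z)) => // leqA.
by rewrite lt0b (le_trans leqA) // lez_nat.
Qed.

Lemma final_decision_mono (V : finType) (Gam : influence_game V)
    (x x' : decisions V) (i : V) :
  supporters x \subset supporters x' ->
  final_decision Gam x i -> final_decision Gam x' i.
Proof.
move=> sxx'; have sF := spreadS Gam (setSI (players Gam) sxx').
have lep : (count_for Gam x i)%:R <= (count_for Gam x' i)%:R :> rat.
  by rewrite ler_nat subset_leq_card // setSI.
have leq : (count_against Gam x' i)%:R <= (count_against Gam x i)%:R :> rat.
  by rewrite ler_nat subset_leq_card // setDS.
rewrite /final_decision; case: ifP => _; first exact/subsetP/spreadS.
case: ifP => [/andP[lefp ltqf] _|_].
  by rewrite (le_trans lefp lep) (le_lt_trans leq ltqf).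
(* What remains is a non-player keeping its own choice x_i = 1. *)
case: ifP => // /negP not_against xi; case: ifP => // _.
(* Pressure towards 0 under [x'] would already be present under [x], against [not_against]. *)
case: ifP => [/andP[lefq ltpf]|_].
  by case: not_against; rewrite (le_trans lefq leq) (le_lt_trans lep ltpf).
by have /subsetP/(_ i) := sxx'; rewrite !inE; apply.
Qed.

Theorem lemma2 (V : finType) (Gam : influence_game V)
    (label_gt0 : forall i : V, 0 < label Gam i) :
  monotonic (oblivious_model Gam) /\ monotonic (non_oblivious_model Gam).
Proof.
split=> x x' sxx'; apply: quota_cardS; first exact/spreadS/setSI.
by apply/subsetP => i; rewrite !inE; apply: final_decision_mono.
Qed.
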